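(* Let $\mathcal{A}_n$ denote either $\mathcal{C}_{n,A}$ for all $n$, or $\mathcal{C}^*_{n,A}$ for all $n$. For all integers $\ell_1,\ell_2\ge0$ and $n\ge0$, \[r_{\ell_1+\ell_2}(\mathcal{A}_n)=\sum_{i=0}^n\binom{n}{i}\, r_{\ell_1}(\mathcal{A}_i)\, r_{\ell_2}(\mathcal{A}_{n-i}).\]
   Context: Let $A=\{a_1,\dots,a_m\}$ with $a_1>\dots>a_m>0$. For $n\ge1$, $\mathcal{C}_{n,A}$ is the arrangement in $\mathbb{R}^n$ of hyperplanes $x_i-x_j=0$ ($i<j$) and $x_i-x_j=a_k$ ($i\ne j$, $1\le k\le m$); $\mathcal{C}^*_{n,A}$ is the arrangement of hyperplanes $x_i-x_j=a_k$ ($i\ne j$, $1\le k\le m$). Regions are connected components of the complement of the union of the hyperplanes. The level of $X\subseteq\mathbb{R}^n$ is the smallest integer $\ell\ge0$ such that there are a linear subspace $W$ of dimension $\ell$ and $r>0$ with $X\subseteq\{\bm x:\min_{\bm y\in W}\|\bm x-\bm y\|\le r\}$. $r_\ell(\mathcal{A})$ is the number of regions of $\mathcal{A}$ of level $\ell$. Convention: for $n=0$ there is exactly one region, of level $0$. *)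

(* Defs.v *)
From HB Require Import structures.
From mathcomp Require Import all_boot all_order all_algebra.
From mathcomp Require Import all_classical all_reals all_analysis.
From mathcomp Require Import Rstruct Rstruct_topology.
From mathcomp Require Import finmap.
From Stdlib Require Import Rdefinitions.


Unset Strict Implicit.
Unset Printing Implicit Defensive.

Import Order.TTheory GRing.Theory Num.Theory.
Local Open Scope classical_set_scope.
Local Open Scope ring_scope.

(* Points of R^n are row vectors 'rV[R]_n; coordinate x_i is x ord0 i
   (coordinates indexed from 0). The topology on 'rV[R]_n is the usual
   (product = Euclidean) one. *)

(* The parameter set A = {a_1 > ... > a_m > 0}, given as the strictly
   decreasing list [:: a_1; ...; a_m] of positive reals, m >= 1. *)
Definition valid_params (A : seq R) : Prop :=
  A != [::] /\ sorted (fun a b => b < a) A /\ all (fun a => 0 < a) A.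

(* Union of hyperplanes of C_{n,A} (star = false) or C*_{n,A} (star = true). *)
Definition on_hyperplane (star : bool) (A : seq R) (n : nat) (x : 'rV[R]_n) : Prop :=
  exists i j : 'I_n,
    ((~~ star) && ltn i j /\ x ord0 i - x ord0 j = 0)
    \/ (i != j /\ exists2 a, a \in A & x ord0 i - x ord0 j = a).

Definition complement (star : bool) (A : seq R) (n : nat) : set 'rV[R]_n :=
  [set x | ~ on_hyperplane star A n x].

Definition is_region (star : bool) (A : seq R) (n : nat) (X : set 'rV[R]_n) : Prop :=
  exists2 x, complement star A n x & X = connected_component (complement star A n) x.

Definition eucl_norm (n : nat) (x : 'rV[R]_n) : R :=
  Num.sqrt (\sum_(i < n) x ord0 i ^+ 2).

(* X lies within distance r of some linear subspace W of dimension l;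
   W is the row space of a square matrix of rank l, and
   min_{y in W} |x - y| <= r is written as: some y in W has |x - y| <= r
   (the minimum is attained since W is closed). *)
Definition near_subspace (n : nat) (X : set 'rV[R]_n) (l : nat) : Prop :=
  exists (W : 'M[R]_n) (r : R),
    \rank W = l /\ 0 < r /\
    forall x, X x -> exists y : 'rV[R]_n, (y <= W)%MS /\ eucl_norm n (x - y) <= r.

Definition has_level (n : nat) (X : set 'rV[R]_n) (l : nat) : Prop :=
  near_subspace n X l /\ forall k, near_subspace n X k -> leq l k.

(* Number of elements of a set of sets (0 if infinite; it is always finite here). *)
Definition nb (T : Type) (S : set (set T)) : nat :=
  if pselect (finite_set S) then #|` fset_set S| else 0.

Definition r_level (star : bool) (A : seq R) (l n : nat) : nat :=
  nb 'rV[R]_n [set X : set 'rV[R]_n | is_region star A n X /\ has_level n X l].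

(* Main.v *)
Require Import Defs.
From Stdlib Require Import Rdefinitions.
From mathcomp Require Import all_classical all_reals all_analysis.
From mathcomp Require Import Rstruct Rstruct_topology.
From mathcomp Require Import finmap.
From mathcomp Require Import all_boot all_order all_algebra.
From mathcomp Require Import ring lra.

(** A region is the set of points realizing one sign pattern of the [x_i - x_j - b].
  Let [a] be the largest parameter, and call a set [I] of indices a cut of [x] if
  [x_i - x_j > a] whenever [i] is in [I] and [j] is not.  The cuts depend only on the
  region and form a chain [set0 = I_0 < I_1 < ... < I_l = setT].  The differences of
  coordinates inside a block [I_(k+1) \ I_k] are bounded, whereas a point of the region
  can be moved freely along the indicator vectors of the cuts, so that [l] is the level.
  A region of level [l1 + l2] then amounts to its cut [I] of height [l1] together with
  its restrictions to [I] and to the complement of [I], which are arbitrary regions of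
  levels [l1] and [l2]. *)

Set Implicit Arguments.
Unset Strict Implicit.
Unset Printing Implicit Defensive.

Import Order.TTheory GRing.Theory Num.Theory numFieldNormedType.Exports.
Local Open Scope ring_scope.

(** * Finite chains of sets *)

Section Chains.
Variables (T : finType) (C : {set {set T}}).
Hypothesis chainC : {in C &, forall I J : {set T}, (I \subset J) || (J \subset I)}.

Definition height (I : {set T}) := #|[set K in C | K \proper I]|.
(* The index [k + 1] of the block [I_(k+1) \ I_k] of the chain that contains [i]. *)
Definition depth (i : T) := #|[set K in C | i \notin K]|.

Lemma height_lt_card I : I \in C -> (height I < #|C|)%N.
Proof.
move=> CI; apply: proper_card; apply/properP; split.
  by apply/subsetP => K; rewrite inE => /andP[].
by exists I => //; rewrite inE properxx andbF.
Qed.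

Lemma height_proper (I J : {set T}) : I \in C -> I \proper J -> (height I < height J)%N.
Proof.
move=> CI ltIJ; apply: proper_card; apply/properP; split.
  apply/subsetP => K; rewrite !inE => /andP[-> ltKI] /=.
  exact: proper_trans ltIJ.
by exists I; rewrite !inE ?CI ?ltIJ ?properxx.
Qed.

Lemma chain_subset I J : I \in C -> J \in C ->
  (I \subset J) = (height I <= height J)%N.
Proof.
move=> CI CJ; apply/idP/idP => [|leh].
  rewrite subEproper => /predU1P[-> //|/height_proper ltIJ].
  exact/ltnW/ltIJ.
case/orP: (chainC CI CJ) => //; rewrite subEproper => /predU1P[-> //|].
by move=> /(height_proper CJ); rewrite ltnNge leh.
Qed.

Lemma height_inj : {in C &, injective height}.
Proof.
move=> I J CI CJ eqh; apply/eqP.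
by rewrite eqEsubset !chain_subset // eqh leqnn.
Qed.

(** [height] maps [C] injectively into ['I_#|C|], so it is onto by cardinality. The default of
    [insubd] never intervenes on [C]. *)
Lemma height_onto k : (k < #|C|)%N -> exists2 I, I \in C & height I = k.
Proof.
move=> ltk; pose h I : 'I_#|C| := insubd (Ordinal ltk) (height I).
have hE I : I \in C -> h I = height I :> nat.
  by move=> CI; rewrite val_insubd height_lt_card.
have hinj : {in C &, injective h}.
  move=> I J CI CJ /(congr1 val); rewrite /= !hE //; exact: height_inj.
have /eqP himg : h @: C == [set: 'I_#|C|].
  by rewrite eqEcard subsetT cardsT card_ord (card_in_imset hinj) leqnn.
have : Ordinal ltk \in h @: C by rewrite himg inE.
by case/imsetP => I CI /(congr1 val) /=; rewrite hE // => ->; exists I.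
Qed.

(** The members that miss [i] form an initial segment of the chain: they all lie strictly below [I]
    if [i] is in [I], and otherwise they include [I] and everything below it. *)
Lemma mem_chain I i : I \in C -> (i \in I) = (depth i <= height I)%N.
Proof.
move=> CI; apply/idP/idP => [iI|].
  apply/subset_leq_card/subsetP => K; rewrite !inE => /andP[CK iK].
  rewrite CK properE /=; case/orP: (chainC CK CI) => [sKI|/subsetP/(_ i iI)].
    by rewrite sKI; apply: contra iK => /subsetP/(_ i iI).
  by rewrite (negPf iK).
apply: contraTT => iI; rewrite -ltnNge; apply: proper_card; apply/properP.
split; last by exists I; rewrite !inE ?CI ?properxx.
apply/subsetP => K; rewrite !inE => /andP[-> /proper_sub/subsetP sKI] /=.
by apply: contra iI => /sKI.
Qed.

(** Any element of the difference of two members of consecutive heights [k] and [k.+1] will do. *)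
Lemma depth_onto k : (k.+1 < #|C|)%N -> exists i, depth i = k.+1.
Proof.
move=> ltk; have [I CI hI] := height_onto ltk.
have [J CJ hJ] := height_onto (ltnW ltk).
have /subsetPn[i] : ~~ (I \subset J) by rewrite chain_subset // hI hJ ltnn.
rewrite !mem_chain // hI hJ -ltnNge => le1 le2.
by exists i; apply/eqP; rewrite eqn_leq le1.
Qed.

Hypotheses (C0 : set0 \in C) (CT : setT \in C).

Lemma depth_gt0 i : (0 < depth i)%N.
Proof. by apply/card_gt0P; exists set0; rewrite !inE C0. Qed.

Lemma depth_lt i : (depth i < #|C|)%N.
Proof.
apply: leq_ltn_trans (height_lt_card CT).
by rewrite -mem_chain ?inE.
Qed.

Lemma card_chain_sub I : I \in C ->
  #|[set K in C | K \subset I]| = (height I).+1.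
Proof.
move=> CI; rewrite (cardsD1 I) !inE CI subxx add1n; congr _.+1.
by apply: eq_card => K; rewrite !inE properEneq; case: (K != I); rewrite ?andbF.
Qed.

Lemma card_chain_sup I : I \in C ->
  #|[set K in C | I \subset K]| = (#|C| - height I)%N.
Proof.
move=> CI; have <- : #|C :\: [set K in C | K \proper I]| = (#|C| - height I)%N.
  rewrite cardsDS //; apply/subsetP => K; rewrite inE => /andP[] //.
apply: eq_card => K; rewrite !inE; case CK: (K \in C) => //=; rewrite ?andbF //.
rewrite andbT properE.
by case/orP: (chainC CI CK) => ->; rewrite ?andbF //= ?negbK.
Qed.

End Chains.

(** * Sign patterns and their cuts *)

Section SignPatterns.
Variables (F : realFieldType) (B : seq F) (a : F).
Hypotheses (aB : a \in B) (leBa : {in B, forall b, 0 <= b <= a}) (a_gt0 : 0 < a).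

Definition generic (T : finType) (x : T -> F) :=
  forall i j, i != j -> x i - x j \notin B.

(** Finite functions make this a finite type, so that regions can be counted through sets of
    patterns. *)
Definition pattern (T : finType) := {ffun T * T -> {ffun 'I_(size B) -> bool}}.

Definition sgp (T : finType) (x : T -> F) : pattern T :=
  [ffun p => [ffun k : 'I_(size B) => x p.1 - x p.2 < B`_k]].

Definition cuts (T : finType) (x : T -> F) : {set {set T}} :=
  [set I : {set T} | [forall i in I, forall j in ~: I, a < x i - x j]].

Lemma sgpP (T : finType) (x y : T -> F) :
  sgp x = sgp y <->
  forall i j b, b \in B -> (x i - x j < b) = (y i - y j < b).
Proof.
split=> [eqxy i j b bB|eqxy].
  have ltb : (index b B < size B)%N by rewrite index_mem.
  move/ffunP/(_ (i, j)): eqxy; rewrite !ffunE => /ffunP/(_ (Ordinal ltb)).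
  by rewrite !ffunE /= nth_index.
by apply/ffunP=> -[i j]; rewrite !ffunE; apply/ffunP=> k;
   rewrite !ffunE /= eqxy // mem_nth.
Qed.

Section Cuts.
Variables (T : finType) (x : T -> F).

Lemma cutsP (I : {set T}) :
  reflect (forall i j, i \in I -> j \notin I -> a < x i - x j) (I \in cuts x).
Proof.
rewrite inE; apply: (iffP forall_inP) => [cutI i j iI jI|cutI i iI].
  by move/forall_inP: (cutI i iI); apply; rewrite inE.
by apply/forall_inP=> j; rewrite inE; apply: cutI.
Qed.

Lemma cuts_chain :
  {in cuts x &, forall I J : {set T}, (I \subset J) || (J \subset I)}.
Proof.
move=> I J /cutsP cutI /cutsP cutJ; apply/norP => -[].
move=> /subsetPn[i iI iJ] /subsetPn[j jJ jI].
have := cutI i j iI jI; have := cutJ j i jJ iJ; have := a_gt0; lra.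
Qed.

Lemma cuts0 : set0 \in cuts x.
Proof. by apply/cutsP => i j; rewrite inE. Qed.

Lemma cutsT : setT \in cuts x.
Proof. by apply/cutsP => i j; rewrite !inE. Qed.

Lemma card_cuts : #|cuts x| = #|cuts x|.-1.+1.
Proof. by rewrite prednK //; apply/card_gt0P; exists set0; apply: cuts0. Qed.

Lemma cut_lt (I : {set T}) i j b : I \in cuts x -> i \in I -> j \notin I ->
  b \in B -> (x i - x j < b) = false /\ x j - x i < b.
Proof.
move=> /cutsP cutI iI jI /leBa/andP[b0 ba]; have := cutI i j iI jI.
by move=> lta; split; [apply/negbTE; rewrite -leNgt|]; have := a_gt0; lra.
Qed.

End Cuts.

(** Since [a] is in [B], genericity excludes a difference equal to [a]; hence being above [a] is the
    negation of being below it, which the pattern records. *)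
Lemma sgp_cuts (T : finType) (x y : T -> F) :
  generic x -> generic y -> sgp x = sgp y -> cuts x = cuts y.
Proof.
have gt_aE z i j : generic z -> i != j -> (a < z i - z j) = ~~ (z i - z j < a).
  move=> gz /gz nB; rewrite -leNgt lt_neqAle andbC; case: (_ <= _) => //=.
  by apply: contraNneq nB => <-.
move=> gx gy /sgpP eqxy; apply/setP => I.
apply/cutsP/cutsP => cutI i j iI jI; have := cutI i j iI jI;
  by rewrite !gt_aE ?eqxy //; apply: contraNneq jI => <-.
Qed.

(** By [sgp_cuts] all generic realizations of a pattern have the same number of cuts, so asking for
    one is enough. The number [l] will turn out to be the level of the region. *)
Definition patterns (T : finType) (l : nat) : {set pattern T} :=
  [set s | `[< exists x : T -> F,
    [/\ generic x, sgp x = s & #|cuts x| = l.+1] >]].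

Lemma patternsP (T : finType) l s :
  reflect (exists x : T -> F, [/\ generic x, sgp x = s & #|cuts x| = l.+1])
    (s \in patterns T l).
Proof. by rewrite inE; apply: asboolP. Qed.

(** * Restriction to a cut and to its complement *)

Section Restriction.
Variables (T T' : finType) (e : T' -> T).
Hypothesis e_inj : injective e.

Definition restrict (s : pattern T) : pattern T' :=
  [ffun p => s (e p.1, e p.2)].

Lemma sgp_comp (x : T -> F) : sgp (x \o e) = restrict (sgp x).
Proof. by apply/ffunP => p; rewrite !ffunE. Qed.

Lemma generic_comp (x : T -> F) : generic x -> generic (x \o e).
Proof. by move=> gx i j neq; apply: gx; rewrite (inj_eq e_inj). Qed.

Variables (x : T -> F) (I : {set T}).
Hypothesis cutI : I \in cuts x.

(** Indices in [I] exceed those outside by more than [a] anyway, so the cuts of the restriction are,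
    through [e], the cuts of [x] contained in [I]. *)
Lemma card_cuts_sub : e @: [set: T'] = I ->
  #|cuts (x \o e)| = (height (cuts x) I).+1.
Proof.
move=> eI; have eIP i : i \in I -> exists u, i = e u.
  by rewrite -eI => /imsetP[u _ ->]; exists u.
rewrite -(card_chain_sub cutI) -(card_imset _ (imset_inj e_inj)).
apply: eq_card => K; rewrite inE; apply/imsetP/andP.
  move=> [K' /cutsP cutK ->]; split; last by rewrite -eI imsetS ?subsetT.
  apply/cutsP => i j /imsetP[u uK ->] jK.
  have eu : e u \in I by rewrite -eI imset_f.
  have [/eIP[v jv]|jI] := boolP (j \in I); last exact: (cutsP _ _ cutI).
  by rewrite jv; apply: cutK => //; apply: contra jK => vK; rewrite jv imset_f.
move=> [/cutsP cutK sKI]; exists (e @^-1: K).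
  by apply/cutsP => u v; rewrite !inE; apply: cutK.
apply/setP => i; apply/idP/imsetP => [iK|[u + ->]]; last by rewrite inE.
by have [u iu] := eIP i (subsetP sKI i iK); exists u; rewrite ?inE -?iu.
Qed.

(** Here the cuts of the restriction are, through [e], the cuts of [x] containing [I], with [I]
    removed. *)
Lemma card_cuts_sup : e @: [set: T'] = ~: I ->
  #|cuts (x \o e)| = (#|cuts x| - height (cuts x) I)%N.
Proof.
move=> eI; have eIP i : i \notin I -> exists u, i = e u.
  by rewrite -in_setC -eI => /imsetP[u _ ->]; exists u.
have eu u : e u \notin I by rewrite -in_setC -eI imset_f.
have h_inj : injective (fun K' : {set T'} => I :|: e @: K').
  move=> K K' /setP eqK; apply/setP => u; have := eqK (e u).
  by rewrite !in_setU (negPf (eu u)) !mem_imset.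
rewrite -(card_chain_sup (@cuts_chain _ x) cutI) -(card_imset _ h_inj).
apply: eq_card => K; rewrite inE; apply/imsetP/andP.
  move=> [K' /cutsP cutK ->]; split; last exact: subsetUl.
  apply/cutsP => i j; rewrite !in_setU negb_or => iK /andP[jI jK].
  have [v jv] := eIP j jI; case/orP: iK => [iI|/imsetP[u uK ->]].
    exact: (cutsP _ _ cutI).
  by rewrite jv; apply: cutK => //; apply: contra jK => vK; rewrite jv imset_f.
move=> [/cutsP cutK sIK]; exists (e @^-1: K).
  by apply/cutsP => u v; rewrite !inE; apply: cutK.
apply/setP => i; rewrite in_setU; have [iI|/eIP[u ->]] := boolP (i \in I).
  by rewrite (subsetP sIK).
by rewrite mem_imset // inE.
Qed.

End Restriction.

(** * Splitting and gluing patterns along a cut *)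

Section Splitting.
Variables (T T1 T2 : finType) (e1 : T1 -> T) (e2 : T2 -> T) (I : {set T}).
Hypotheses (e1_inj : injective e1) (e2_inj : injective e2).
Hypotheses (e1I : e1 @: [set: T1] = I) (e2I : e2 @: [set: T2] = ~: I).

Variant split_spec : T -> Prop :=
  | Split1 u : e1 u \in I -> split_spec (e1 u)
  | Split2 v : e2 v \notin I -> split_spec (e2 v).

Lemma splitP i : split_spec i.
Proof.
have [|] := boolP (i \in I).
  by rewrite -e1I => /imsetP[u _ ->]; constructor; rewrite -e1I imset_f.
rewrite -in_setC -e2I => /imsetP[v _ ->]; constructor.
by rewrite -in_setC -e2I imset_f.
Qed.

Lemma e1_in u : e1 u \in I. Proof. by rewrite -e1I imset_f. Qed.

Lemma e2_notin v : e2 v \notin I.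
Proof. by rewrite -in_setC -e2I imset_f. Qed.

(** Raising all of [x1] far above [x2] by one constant makes [I] a cut and leaves the differences
    within each side unchanged. *)
Lemma glue (x1 : T1 -> F) (x2 : T2 -> F) : generic x1 -> generic x2 ->
  exists x : T -> F, [/\ generic x, I \in cuts x,
    sgp (x \o e1) = sgp x1 & sgp (x \o e2) = sgp x2].
Proof.
(* The two sums dominate every [|x1 u|] and [|x2 v|], so [M + x1 u - x2 v] exceeds [a]. The last
   default [0] in [x] is never reached, as [e1] and [e2] cover [T]. *)
move=> gx1 gx2; pose M := a + 1 + \sum_u `|x1 u| + \sum_v `|x2 v|.
pose x i := if [pick u | e1 u == i] is Some u then M + x1 u else
  if [pick v | e2 v == i] is Some v then x2 v else 0.
have xe1 u : x (e1 u) = M + x1 u.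
  rewrite /x; case: pickP => [u' /eqP/e1_inj-> //|/(_ u)]; by rewrite eqxx.
have xe2 v : x (e2 v) = x2 v.
  rewrite /x; case: pickP => [u /eqP e12|_].
    by have := e2_notin v; rewrite -e12 e1_in.
  case: pickP => [v' /eqP/e2_inj-> //|/(_ v)]; by rewrite eqxx.
have dx1 u v : x (e1 u) - x (e1 v) = x1 u - x1 v by rewrite !xe1; lra.
have far u v : a < x (e1 u) - x (e2 v).
  rewrite xe1 xe2 /M (bigD1 u) //= (bigD1 v) //=.
  have : 0 <= \sum_(i | i != u) `|x1 i| by apply: sumr_ge0.
  have : 0 <= \sum_(i | i != v) `|x2 i| by apply: sumr_ge0.
  have := ler_norm (x2 v); have := ler_norm (- x1 u); rewrite normrN; lra.
exists x; split.
(* Differences across the cut are above [a] or below [- a], hence outside [B], which lies in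
   [[0, a]]. *)
- move=> i j; case: (splitP i) => u _; case: (splitP j) => v _ neq.
  + rewrite dx1; apply: gx1; apply: contraNneq neq => ->; exact: eqxx.
  + by apply: contraL (far u v) => /leBa/andP[_]; rewrite leNgt.
  + apply: contraL (far v u) => /leBa/andP[h _]; rewrite -leNgt.
    have := a_gt0; lra.
  + rewrite !xe2; apply: gx2; apply: contraNneq neq => ->; exact: eqxx.
- apply/cutsP => i j; case: (splitP i) => u; last by move/negPf=> ->.
  by case: (splitP j) => v; [move=> + _ => ->|].
- by apply/sgpP => u v b _ /=; rewrite dx1.
- by apply/sgpP => u v b _ /=; rewrite !xe2.
Qed.

Definition cut_patterns l1 l2 : {set pattern T} :=
  [set s | `[< exists x : T -> F, [/\ generic x, sgp x = s, I \in cuts x,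
    height (cuts x) I = l1 & #|cuts x| = (l1 + l2).+1] >]].

(** Restricting to both sides is a bijection: the signs across the cut are forced, which gives
    injectivity, and [glue] gives surjectivity. *)
Lemma card_cut_patterns l1 l2 :
  #|cut_patterns l1 l2| = (#|patterns T1 l1| * #|patterns T2 l2|)%N.
Proof.
pose res s := (restrict e1 s, restrict e2 s).
rewrite -cardsX -(@card_in_imset _ _ res); last first.
  move=> _ _ /[!inE] /asboolP[x [gx <- cx _ _]] /asboolP[y [gy <- cy _ _]].
  case; rewrite -!sgp_comp => /sgpP eq1 /sgpP eq2; apply/sgpP => i j b bB.
  case: (splitP i) => u iI; case: (splitP j) => v jI.
  - exact: eq1.
  - by have [-> _] := cut_lt cx iI jI bB; have [-> _] := cut_lt cy iI jI bB.
  - by have [_ ->] := cut_lt cx jI iI bB; have [_ ->] := cut_lt cy jI iI bB.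
  - exact: eq2.
apply: eq_card => -[s1 s2]; rewrite in_setX; apply/imsetP/andP => /=.
  move=> [_ /[!inE] /asboolP[x [gx <- cx hx nx]] [-> ->]].
  rewrite -!sgp_comp; split; apply/asboolP; [exists (x \o e1)|exists (x \o e2)].
    by split=> //; [apply: generic_comp|rewrite (card_cuts_sub e1_inj cx) ?hx].
  split=> //; [exact: generic_comp|rewrite (card_cuts_sup e2_inj cx) // hx nx].
  by rewrite subSn ?leq_addr // addKn.
move=> [/patternsP[x1 [g1 <- n1]] /patternsP[x2 [g2 <- n2]]].
have [x [gx cx sx1 sx2]] := glue g1 g2.
exists (sgp x); last by rewrite /res -!sgp_comp sx1 sx2.
(* The restrictions of [x] have the patterns, hence the cuts, of [x1] and [x2]; their numbers
   determine the height of [I] and the number of cuts of [x]. *)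
have := card_cuts_sub e1_inj cx e1I.
rewrite (sgp_cuts _ g1 sx1); last exact: generic_comp.
have := card_cuts_sup e2_inj cx e2I.
rewrite (sgp_cuts _ g2 sx2); last exact: generic_comp.
rewrite n1 n2 => hsup [hsub]; rewrite inE; apply/asboolP; exists x; split=> //.
by rewrite -addnS hsup hsub subnKC // ltnW // height_lt_card.
Qed.

End Splitting.

(** Among [l1 + l2 + 1] cuts forming a chain exactly one has height [l1]; sorting the patterns by
    this cut partitions them. *)
Lemma card_patterns_split (T : finType) l1 l2 :
  #|patterns T (l1 + l2)| =
  (\sum_(I : {set T}) #|patterns 'I_#|I| l1| * #|patterns 'I_#|~: I| l2|)%N.
Proof.
have enumI (I : {set T}) : (@enum_val T (mem I)) @: [set: 'I_#|I|] = I.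
  apply/setP => i; apply/imsetP/idP => [[k _ ->]|iI]; first exact: enum_valP.
  by exists (enum_rank_in iI i); rewrite ?inE // enum_rankK_in.
under eq_bigr => I _ do rewrite -(card_cut_patterns
  enum_val_inj enum_val_inj (enumI I) (enumI (~: I)) l1 l2) -sum1_card.
rewrite -partition_disjoint_bigcup /=; last first.
  move=> I J neqIJ; apply/pred0P => s /=; apply: contraNF neqIJ.
  rewrite !inE => /andP[/asboolP[x [gx sx cx hx _]] /asboolP[y [gy sy]]].
  rewrite (@sgp_cuts _ y x) ?sx // => cy hy _.
  by apply/eqP/(height_inj (@cuts_chain _ x) cx cy); rewrite hx.
rewrite sum1_card; apply: eq_card => s; apply/patternsP/bigcupP.
  move=> [x [gx sx nx]].
  have [|I cI hI] := height_onto (@cuts_chain _ x) (k := l1).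
    by rewrite nx ltnS leq_addr.
  by exists I => //; rewrite inE; apply/asboolP; exists x.
by move=> [I _ /[!inE] /asboolP[x [gx sx _ _ nx]]]; exists x.
Qed.

(** The summand depends only on the size of [I], and ['C(n, i)] subsets have size [i]. *)
Lemma card_patterns_convolution n l1 l2 :
  #|patterns 'I_n (l1 + l2)| = (\sum_(0 <= i < n.+1)
    'C(n, i) * #|patterns 'I_i l1| * #|patterns 'I_(n - i) l2|)%N.
Proof.
rewrite card_patterns_split big_mkord.
pose c (I : {set 'I_n}) : 'I_n.+1 := inord #|I|.
have cE I : c I = #|I| :> nat.
  by rewrite inordK // ltnS -[n in (_ <= n)%N]card_ord max_card.
rewrite (partition_big c xpredT) //=; apply: eq_bigr => k _.
rewrite -mulnA -[n in 'C(n, _)]card_ord -card_draws -sum_nat_const.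
rewrite [RHS](eq_bigl (fun I => c I == k)) => [|I]; last first.
  by rewrite inE -val_eqE /= cE.
apply: eq_bigr => I /eqP <-; rewrite cE.
by rewrite [in LHS](_ : #|~: I| = n - #|I|)%N // cardsCs setCK card_ord.
Qed.

End SignPatterns.

(** * Sign classes as connected components *)

Lemma segment_avoids (F : realFieldType) (u v b t : F) :
  u != b -> v != b -> (u < b) = (v < b) -> 0 <= t -> t <= 1 ->
  u + t * (v - u) != b.
Proof.
move=> ub vb + t0 t1; case: (ltgtP u b) ub => // ub _; case: ltgtP vb => // vb _ _.
  rewrite lt_eqF //; case: (leP u v) => uv.
    have : 0 <= (1 - t) * (v - u) by rewrite mulr_ge0 // subr_ge0.
    by lra.
  have : 0 <= t * (u - v) by rewrite mulr_ge0 // subr_ge0 ltW.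
  by lra.
rewrite gt_eqF //; case: (leP u v) => uv.
  have : 0 <= t * (v - u) by rewrite mulr_ge0 // subr_ge0.
  by lra.
have : 0 <= (1 - t) * (u - v) by rewrite mulr_ge0 // subr_ge0 // ltW.
by lra.
Qed.

Section Components.
Variables (K : realType) (B : seq K) (n : nat).
Implicit Types x y : 'rV[K]_n.

Definition generic_points : set 'rV[K]_n := fun x => generic B (x ord0).

Definition sgp_class (s : pattern B 'I_n) : set 'rV[K]_n :=
  fun x => generic_points x /\ sgp B (x ord0) = s.

Lemma continuous_coordB (i j : 'I_n) :
  continuous (fun z : 'rV[K]_n => z ord0 i - z ord0 j).
Proof.
move=> z; exact: (cvgB (@coord_continuous K 1 n ord0 i z)
  (@coord_continuous K 1 n ord0 j z)).
Qed.

Lemma continuous_line x y : continuous (fun t : K => x + t *: y).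
Proof. by move=> t; apply: cvgD; [exact: cvg_cst|exact: scalel_continuous]. Qed.

Lemma sgp_class_component x : generic_points x ->
  connected_component generic_points x = sgp_class (sgp B (x ord0)).
Proof.
move=> gx; apply/seteqP; split=> y.
  move=> [C [Cx CS Cc] Cy]; split; first exact: CS.
  apply/sgpP => i j b bB.
  have [->|neq] := eqVneq i j; first by rewrite !subrr.
  (* The image of [C] under [f] is an interval that omits [b] by genericity, so [f] stays on one
     side of [b]. *)
  pose f (z : 'rV[K]_n) := z ord0 i - z ord0 j.
  have /connected_intervalP fI : connected (f @` C)%classic.
    apply: connected_continuous_connected => //; apply: continuous_subspaceT.
    exact: continuous_coordB.
  have fC z : C z -> (f @` C)%classic (f z) by move=> Cz; exists z.
  have key u v : C u -> C v -> f u < b -> f v < b.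
    move=> Cu Cv ub; rewrite ltNge; apply/negP => bv.
    have [|w Cw fw] := fI _ _ (fC _ Cu) (fC _ Cv) b.
      by rewrite bv ltW.
    by move: (CS w Cw _ _ neq); rewrite -[_ - _]/(f w) fw bB.
  by apply/idP/idP; apply: key.
move=> [gy /sgpP eqxy].
(* Conversely, the segment from [x] to [y] stays generic: every difference of coordinates has its
   two end values on the same side of each threshold. *)
pose g (t : K) : 'rV[K]_n := x + t *: (y - x).
have g0 : g 0 = x by rewrite /g scale0r addr0.
have g1 : g 1 = y by rewrite /g scale1r addrC subrK.
exists (g @` `[0, 1])%classic.
  split.
  - by exists 0 => //=; rewrite in_itv /= lexx ler01.
  - move=> _ [t + <-]; rewrite /= in_itv /= => /andP[t0 t1].
    move=> i j neq; set b := _ - _; apply/negP => bB.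
    have nx : x ord0 i - x ord0 j != b by apply: contraNneq (gx i j neq) => ->.
    have ny : y ord0 i - y ord0 j != b by apply: contraNneq (gy i j neq) => ->.
    have := segment_avoids nx ny (esym (eqxy i j b bB)) t0 t1.
    by move/eqP; apply; rewrite /b /g !mxE; ring.
  - apply: connected_continuous_connected; first exact: segment_connected.
    apply: continuous_subspaceT; exact: continuous_line.
by exists 1 => //=; rewrite in_itv /= lexx ler01.
Qed.

End Components.

(** * The arrangements in terms of thresholds *)

Section Regions.
Variables (star : bool) (A : seq R).
Hypothesis A_ok : valid_params A.

(** The threshold [0] stands for the hyperplanes [x_i = x_j], present only in the unstarred
    arrangement. *)
Definition thresholds := if star then A else 0 :: A.

(** The parameters decrease, so the head of [A] is the largest; [A] is nonempty, so the default of
    [head] is not reached. *)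
Lemma head_thresholds : [/\ head 0 A \in thresholds,
  {in thresholds, forall b, 0 <= b <= head 0 A} & 0 < head 0 A].
Proof.
case: A_ok; rewrite /thresholds; case: A => // a A' _ [sA /=/andP[a0 A0]].
have leA : {in a :: A', forall b, 0 <= b <= a}.
  move=> b /[!inE] /predU1P[->|bA]; first by rewrite lexx ltW.
  rewrite ltW ?(allP A0) //= ltW //.
  move: sA; rewrite /= path_sortedE; last by move=> x y z xy /lt_trans; apply.
  by case/andP=> /allP/(_ b bA).
split=> //; first by case: star; rewrite !inE eqxx ?orbT.
by case: star => // b /[1!inE] /predU1P[->|/leA //]; rewrite lexx ltW.
Qed.

Lemma complementE n : complement star A n = generic_points thresholds (n := n).
Proof.
apply/seteqP; split=> x => [ncx i j neq|gx [i [j []]]].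
- apply/negP => xB; apply: ncx; move: xB; rewrite /thresholds.
  case: ifPn => nstar; last rewrite inE.
    by exists i, j; right; split=> //; exists (x ord0 i - x ord0 j).
  case/predU1P=> [x0|xA]; last first.
    by exists i, j; right; split=> //; exists (x ord0 i - x ord0 j).
  move: neq; rewrite neq_ltn => /orP[ltij|ltji]; first by exists i, j; left.
  by exists j, i; left; split=> //; lra.
- move=> [/andP[nstar ltij] x0].
  have /gx : i != j by rewrite neq_ltn (ltij : (i < j)%N).
  by rewrite x0 /thresholds (negPf nstar) inE eqxx.
- move=> [/gx nB [b bA xb]]; move: nB; rewrite xb /thresholds.
  by case: star; rewrite ?inE bA ?orbT.
Qed.

Lemma is_regionE n (X : set 'rV[R]_n) : is_region star A n X <->
  exists2 x, generic_points thresholds x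
  & X = sgp_class (sgp thresholds (x ord0)).
Proof.
rewrite /is_region complementE; split=> -[x gx ->]; exists x => //;
  by rewrite sgp_class_component.
Qed.

End Regions.

(** * Bounded blocks, free shifts and the level of a region *)

Lemma block_bounded (F : realFieldType) (a : F) (T : finType) (x : T -> F) i i' :
  0 < a -> depth (cuts a x) i = depth (cuts a x) i' ->
  x i - x i' <= a *+ #|T|.
Proof.
move=> a0 eqd; rewrite leNgt; apply/negP => far.
(* By pigeonhole some interval of length [a] between [x i'] and [x i] contains no
   coordinate; the coordinates above it form a cut separating [i] from [i']. *)
have hit (k : 'I_#|T|) : exists j, (a *+ k < x j - x i') && (x j - x i' <= a *+ k.+1).
  apply/existsP; apply: contraT; rewrite negb_exists => /forallP nohit.
  have nk j : a *+ k < x j - x i' -> a *+ k.+1 < x j - x i'.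
    by move=> lt1; have := nohit j; rewrite lt1 /= -ltNge.
  have cJ : [set j | a *+ k.+1 < x j - x i'] \in cuts a x.
    apply/cutsP => u v; rewrite !inE => hu hv.
    have : ~~ (a *+ k < x v - x i') by apply: contra hv => /nk.
    by move: hu; rewrite -leNgt mulrSr; lra.
  have := mem_chain (@cuts_chain _ a a0 _ x) i cJ; rewrite eqd.
  rewrite -(mem_chain (@cuts_chain _ a a0 _ x) i' cJ) !inE.
  have -> : a *+ k.+1 < x i - x i'.
    by apply: le_lt_trans far; rewrite ler_pMn2l // ltn_ord.
  by rewrite subrr => /esym; rewrite ltNge mulrn_wge0 // ltW.
have [f fP] := fin_all_exists hit.
have f_inj : injective f.
  move=> k k' eqf; have /andP[h1 h2] := fP k; have /andP[] := fP k'.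
  rewrite -eqf => h3 h4; have := lt_le_trans h1 h4; have := lt_le_trans h3 h2.
  by rewrite !ltr_pMn2l // !ltnS => le1 le2; apply/val_inj/eqP; rewrite eqn_leq le1 le2.
(* [f] is injective between sets of equal size, so it takes the value [i']; but the difference at
   [i'] is [0], which lies in none of the intervals. *)
have [|g _ fg] := inj_card_bij f_inj; first by rewrite card_ord.
have := fP (g i'); rewrite fg subrr => /andP[+ _].
by rewrite ltNge mulrn_wge0 // ltW.
Qed.

(** Raising a cut only widens the differences across it, already beyond [a] in absolute value, and
    fixes all others. *)
Lemma shift_cut (F : realFieldType) (B : seq F) (a : F) (T : finType)
    (x y : T -> F) (I : {set T}) t :
  {in B, forall b, 0 <= b <= a} -> 0 < a ->
  I \in cuts a x -> generic B x -> 0 <= t ->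
  (forall i, y i = x i + t * (i \in I)%:R) ->
  generic B y /\ sgp B y = sgp B x.
Proof.
move=> leBa a0 /cutsP cutI gx t0 yE.
have up i j : i \in I -> j \notin I -> a < y i - y j.
  move=> iI jI; have := cutI i j iI jI; rewrite !yE iI (negPf jI) mulr1 mulr0; lra.
have same i j : (i \in I) = (j \in I) -> y i - y j = x i - x j.
  by move=> eqI; rewrite !yE eqI; lra.
split=> [i j neq|].
  have [iI|iI] := boolP (i \in I); have [jI|jI] := boolP (j \in I).
  - by rewrite same ?gx // iI jI.
  - by apply: contraL (up i j iI jI) => /leBa/andP[_]; rewrite leNgt.
  - apply: contraL (up j i jI iI) => /leBa/andP[? _]; rewrite -leNgt; lra.
  - by rewrite same ?gx // (negPf iI) (negPf jI).
apply/sgpP => i j b /leBa/andP[b0 ba].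
have [iI|iI] := boolP (i \in I); have [jI|jI] := boolP (j \in I).
- by rewrite same // iI jI.
- have := up i j iI jI; have := cutI i j iI jI => h1 h2.
  by apply/idP/idP => ?; lra.
- have := up j i jI iI; have := cutI j i jI iI => h1 h2.
  by apply/idP/idP => ?; lra.
- by rewrite same // (negPf iI) (negPf jI).
Qed.

Section BlockMatrix.
Variables (F : fieldType) (n : nat) (C : {set {set 'I_n}}).
Hypothesis chainC : {in C &, forall I J : {set 'I_n}, (I \subset J) || (J \subset I)}.
Hypotheses (C0 : set0 \in C) (CT : setT \in C).

(** Row [k] is the indicator of a block; depths start at [1] because [set0] misses every index,
    whence the shift. *)
Definition blockmx : 'M[F]_(#|C|.-1, n) :=
  \matrix_(k, i) (depth C i == k.+1)%:R.

Definition indicator_row (I : {set 'I_n}) : 'rV[F]_n := \row_i (i \in I)%:R.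

Lemma rank_blockmx : \rank blockmx = #|C|.-1.
Proof.
have dP (k : 'I_#|C|.-1) : exists i, depth C i = k.+1.
  by apply: depth_onto; rewrite -?ltn_predRL.
have [p pP] := fin_all_exists dP.
(* Choosing one index [p k] in each block gives a right inverse. *)
apply/eqP/row_freeP; exists (\matrix_(i, k) (i == p k)%:R).
apply/matrixP => k k'; rewrite !mxE (bigD1 (p k')) //= big1 => [|i neq].
  by rewrite !mxE eqxx mulr1 addr0 pP eqSS eq_sym.
by rewrite !mxE (negPf neq) mulr0.
Qed.

(** Each row is the difference of the indicators of two consecutive members of the chain. *)
Lemma blockmx_sub (W : 'M[F]_n) :
  (forall I, I \in C -> (indicator_row I <= W)%MS) -> (blockmx <= W)%MS.
Proof.
move=> subW; apply/row_subP => k.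
have ltk : (k.+1 < #|C|)%N by rewrite -ltn_predRL.
have [I CI hI] := height_onto chainC ltk.
have [J CJ hJ] := height_onto chainC (ltnW ltk).
suff -> : row k blockmx = indicator_row I - indicator_row J.
  by rewrite addmx_sub ?eqmx_opp ?subW.
apply/rowP => i; rewrite !mxE (mem_chain chainC i CI) (mem_chain chainC i CJ) hI hJ.
rewrite eqn_leq.
have [le1|lt1] := leqP (depth C i) k; last by rewrite andbT subr0.
by rewrite andbF (leq_trans le1 (leqnSn k)) subrr.
Qed.

Lemma mul_blockmx (v : 'I_#|C|.-1 -> F) (i : 'I_n) :
  exists2 k : 'I_#|C|.-1, depth C i = k.+1
  & (\row_k v k *m blockmx) ord0 i = v k.
Proof.
have d0 := depth_gt0 C0 i; have dlt := depth_lt chainC CT i.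
have ltd : ((depth C i).-1 < #|C|.-1)%N by rewrite -ltnS !prednK // (leq_ltn_trans _ dlt).
exists (Ordinal ltd) => /=; first by rewrite prednK.
rewrite !mxE (bigD1 (Ordinal ltd)) //= big1 => [|k neq].
  by rewrite !mxE /= prednK // eqxx mulr1 addr0.
by rewrite !mxE -(prednK d0) eqSS eq_sym -[_ == _]/(k == Ordinal ltd) (negPf neq) mulr0.
Qed.

End BlockMatrix.

Lemma bounded_line_slope0 (F : realFieldType) (u v M : F) :
  (forall t, 0 <= t -> `|v + t * u| <= M) -> u = 0.
Proof.
move=> bnd; apply/eqP; apply: contraT => u0.
have M0 : 0 <= M by apply: le_trans (bnd 0 (lexx _)).
have nu : 0 < `|u| by rewrite normr_gt0.
(* With this [t] the size of [t * u] is [M + |v| + 1], so [v + t * u] would exceed [M] in absolute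
   value. *)
have t0 : 0 <= (M + `|v| + 1) / `|u| by rewrite divr_ge0 // !addr_ge0.
have := bnd _ t0; have := lerB_normD (((M + `|v| + 1) / `|u|) * u) v.
rewrite normrM ger0_norm // divfK ?normr_eq0 // [v + _]addrC.
set w := `|_ + v|; have := normr_ge0 v; lra.
Qed.

Lemma coord_le_eucl_norm n (v : 'rV[R]_n) i : `|v ord0 i| <= eucl_norm n v.
Proof.
rewrite /eucl_norm -sqrtr_sqr ler_wsqrtr // (bigD1 i) //= lerDl.
by apply: sumr_ge0 => j _; apply: sqr_ge0.
Qed.

Lemma eucl_norm_le n (v : 'rV[R]_n) c : (forall i, `|v ord0 i| <= c) ->
  eucl_norm n v <= Num.sqrt (c ^+ 2 *+ n).
Proof.
move=> vc; rewrite /eucl_norm ler_wsqrtr //.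
rewrite -[n in X in _ <= X]card_ord -sumr_const; apply: ler_sum => i _.
by rewrite -(real_normK (num_real _)) lerXn2r ?nnegrE // (le_trans _ (vc i)).
Qed.

Section Levels.
Variables (B : seq R) (a : R).
Hypotheses (leBa : {in B, forall b, 0 <= b <= a}) (a_gt0 : 0 < a) (aB : a \in B).
Variables (n : nat) (x : 'rV[R]_n).
Hypothesis gx : generic_points B x.
Let C := cuts a (x ord0).
Let X := sgp_class (sgp B (x ord0)).

(** Upper bound on the level: replacing the coordinates in each block by that of one representative
    gives a point of the row space, and [block_bounded] bounds each coordinate of the error by
    [a *+ n]. *)
Lemma near_blockmx : near_subspace n X #|C|.-1.
Proof.
(* Generating gives the square matrix required; the [+ 1] keeps the radius positive even for
   [n = 0]. *)
exists <<blockmx R C>>%MS, (Num.sqrt ((a *+ n) ^+ 2 *+ n) + 1).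
have chainC := @cuts_chain _ a a_gt0 _ (x ord0).
split; first by rewrite mxrank_gen rank_blockmx.
split; first by rewrite ltr_pwDr ?sqrtr_ge0.
move=> z [gz eqz]; have eqC : C = cuts a (z ord0) by apply: (sgp_cuts aB).
have dP (k : 'I_#|C|.-1) : exists i, depth C i = k.+1.
  by apply: depth_onto; rewrite -?ltn_predRL.
have [p pP] := fin_all_exists dP.
exists (\row_k z ord0 (p k) *m blockmx R C); split.
  by rewrite genmxE submxMl.
apply: le_trans (_ : _ <= Num.sqrt ((a *+ n) ^+ 2 *+ n)) _; last by rewrite lerDl.
apply: eucl_norm_le => i.
have [k dk mk] := mul_blockmx chainC (cuts0 _ _) (cutsT _ _)
  (fun k => z ord0 (p k)) i.
rewrite mxE [X in _ + X]mxE mk.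
have eqd : depth (cuts a (z ord0)) i = depth (cuts a (z ord0)) (p k).
  by rewrite -eqC pP.
have := block_bounded a_gt0 eqd; have := block_bounded a_gt0 (esym eqd).
by rewrite card_ord ler_norml => h1 h2; rewrite h2 andbT; lra.
Qed.

(** Lower bound: the ray from [x] along the indicator of a cut stays in the region, hence near [W],
    which forces its direction into [W]. So [W] contains all rows of [blockmx]. *)
Lemma near_subspace_level k : near_subspace n X k -> (#|C|.-1 <= k)%N.
Proof.
move=> [W [r [<- [r0 nearW]]]].
have chainC := @cuts_chain _ a a_gt0 _ (x ord0).
rewrite -(rank_blockmx R chainC).
apply/mxrankS/blockmx_sub => // I CI; rewrite submxE; apply/eqP/matrixP => i q.
rewrite ord1 [RHS]mxE.
(* [N] kills [W], so [xt *m N] equals [(xt - y) *m N], whose entry [q] is bounded by [M] for every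
   [t]. *)
pose N := cokermx W; pose M := \sum_i r * `|N i q|.
apply: (@bounded_line_slope0 _ _ ((x *m N) ord0 q) M) => t t0.
pose xt := x + t *: indicator_row R I.
have Xxt : X xt.
  apply: (shift_cut leBa a_gt0 CI gx t0) => j; by rewrite !mxE.
have [y [yW dy]] := nearW xt Xxt.
have yN : y *m N = 0 by apply/eqP; rewrite -submxE.
have -> : (x *m N) ord0 q + t * (indicator_row R I *m N) ord0 q
    = ((xt - y) *m N) ord0 q.
  by rewrite mulmxBl yN subr0 mulmxDl -scalemxAl [RHS]mxE [X in _ = _ + X]mxE.
rewrite mxE; apply: le_trans (ler_norm_sum _ _ _) _; apply: ler_sum => j _.
rewrite normrM ler_wpM2r //; apply: le_trans dy; exact: coord_le_eucl_norm.
Qed.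

Lemma has_levelE l : has_level n X l <-> #|C| = l.+1.
Proof.
have cC : #|C| = #|C|.-1.+1 := card_cuts _ _.
split=> [[nearl minl]|eql].
  rewrite cC; congr _.+1; apply/eqP; rewrite eqn_leq near_subspace_level //=.
  exact: minl near_blockmx.
have <- : #|C|.-1 = l by rewrite eql.
by split; [exact: near_blockmx|exact: near_subspace_level].
Qed.

End Levels.

(** * Counting regions by patterns *)

Lemma nb_image (T : finType) (U : Type) (f : T -> set U) (D : {set T}) :
  {in D &, injective f} -> nb U (f @` [set` D])%classic = #|D|.
Proof.
move=> f_inj; have finD : finite_set [set` D]%classic := finite_finpred _.
rewrite /nb; case: pselect => [?|[]]; last exact: finite_image.
rewrite fset_set_image // card_in_imfset /= => [|s s'].
  rewrite -(card_finset (mem D)); congr #|` _|; apply/fsetP => s.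
  by rewrite in_fset_set // mem_setE in_fset.
rewrite !in_fset_set // !mem_setE; exact: f_inj.
Qed.

Section Counting.
Variables (star : bool) (A : seq R).
Hypothesis A_ok : valid_params A.
Let B := thresholds star A.
Let a := head 0 A.

Lemma r_level_patterns l n : r_level star A l n = #|patterns B a 'I_n l|.
Proof.
have [aB leBa a_gt0] := head_thresholds star A_ok.
have -> : r_level star A l n
    = nb _ (@sgp_class _ B n @` [set` patterns B a 'I_n l])%classic.
  congr nb; apply/seteqP; split=> X.
    move=> [/is_regionE[x gx ->] /(has_levelE leBa a_gt0 aB gx) cx].
    by exists (sgp B (x ord0)) => //; apply/patternsP; exists (x ord0).
  move=> [s /patternsP[f [gf <- cf]] <-].
  pose x : 'rV[R]_n := \row_i f i.
  have xE : x ord0 = f by apply/funext => i; rewrite mxE.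
  rewrite -xE in gf cf *; split; last exact/(has_levelE leBa a_gt0 aB gf).
  by apply/is_regionE; exists x.
(* A realized pattern has a nonempty class, any point of which gives the pattern back. *)
have inj : {in patterns B a 'I_n l &, injective (@sgp_class _ B n)}.
  move=> s s' /patternsP[f [gf sf _]] _ eqs.
  pose x : 'rV[R]_n := \row_i f i.
  have xE : x ord0 = f by apply/funext => i; rewrite mxE.
  have : sgp_class s x by split; rewrite /generic_points xE.
  by rewrite eqs => -[_ <-]; rewrite xE.
exact: nb_image.
Qed.

End Counting.

(* star = false : A_n = C_{n,A};  star = true : A_n = C*_{n,A}. *)
Theorem theorem1p4 (star : bool) (A : seq R) (l1 l2 n : nat) :
  valid_params A ->
  r_level star A (l1 + l2) n =
  (\sum_(0 <= i < n.+1) 'C(n, i) * r_level star A l1 i * r_level star A l2 (n - i))%N.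
Proof.
move=> A_ok; have [aB leBa a_gt0] := head_thresholds star A_ok.
rewrite !r_level_patterns // (card_patterns_convolution aB leBa a_gt0).
by apply: eq_bigr => i _; rewrite !r_level_patterns.
Qed.
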